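(* Let $H_1$ and $H_2$ be distinct simple graphs with vertex set $[n]$. Then $H_1-H_2$ is not a modular relation for $X$ (and thus also not a modular relation for $XB$).
   Context: Write $[n]=\{1,\dots,n\}$, $n\ge1$. A graph is a finite vertex set $V(G)$ together with a finite multiset $E(G)$ of unordered pairs of not necessarily distinct vertices; it is simple if it has no loops and no multi-edges. Graphs are labelled: $H_1$ and $H_2$ are distinct if $E(H_1)\ne E(H_2)$ (they may be isomorphic). $\mathbb{G}$ is the $\mathbb{C}$-vector space freely generated by all graphs whose vertex set is $[n]$ for some $n\ge 1$; $\mathbb{G}[t]$ consists of formal linear combinations of such graphs with coefficients in $\mathbb{C}[t]$. Chromatic symmetric function: $X_G=\sum_{\kappa}\prod_{v\in V(G)}x_{\kappa(v)}$, summed over maps $\kappa:V(G)\to\{1,2,3,\dots\}$ with $\kappa(v_1)\ne\kappa(v_2)$ whenever $v_1v_2\in E(G)$ (so $X_G=0$ if $G$ has a loop). Tutte symmetric function: $XB_G=\sum_{\kappa}(1+t)^{e(\kappa)}\prod_{v\in V(G)}x_{\kappa(v)}$, summed over all maps $\kappa:V(G)\to\{1,2,3,\dots\}$, where $e(\kappa)$ is the number of edges of $G$ (with multiplicity, including loops) whose endpoints receive the same value. Extend linearly to $X:\mathbb{G}\to\Lambda$ and $\mathbb{C}[t]$-linearly to $XB:\mathbb{G}[t]\to\Lambda[t]$, where $\Lambda$ is the algebra of symmetric functions over $\mathbb{C}$ in $x_1,x_2,\dots$. Extension: $G\uplus E$ denotes the graph with vertex set $V(G)$ and edge multiset $E(G)\uplus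 E$ (multiplicities are added). For $L=\sum_i c_iH_i$ with all $H_i$ graphs on $[n]$ (coefficients in $\mathbb{C}$ or $\mathbb{C}[t]$) and a graph $G$ on $[N]$, $N\ge n$, set $Ext(L;G)=\sum_i c_i\,(G\uplus E(H_i))$. Modular relation: a linear combination $L$ of graphs with vertex set $[n]$ in $\mathbb{G}$ (resp. $\mathbb{G}[t]$) is a modular relation for $X$ (resp. for $XB$) if for every $N\ge n$ and every graph $G$ with vertex set $[N]$, $Ext(L;G)$ lies in $Ker(X)$ (resp. $Ker(XB)$). *)

(* Defs.v *)
From HB Require Import structures.
From mathcomp Require Import all_boot all_algebra.
From mathcomp Require Import finmap multiset.
From mathcomp Require Import boolp classical_sets functions cardinality fsbigop.
From mathcomp Require Import reals complex.
From mathcomp Require Import monalg freeg.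

Set Implicit Arguments.
Unset Strict Implicit.
Unset Printing Implicit Defensive.

Import GRing.Theory.

Local Open Scope classical_set_scope.
Local Open Scope ring_scope.

(** Basis elements of [{freeg T / K}]; without this the notation of [monalg]
    would take precedence over that of [freeg]. *)
Local Notation "<< x >>" := [freeg [:: (1, x)]] : ring_scope.

(** The unordered pair {u, v}, possibly with u = v, is represented by its
    increasing listing. *)
Definition edge (n : nat) := {e : 'I_n * 'I_n | (e.1 <= e.2)%N}.

HB.instance Definition _ n := Finite.on (edge n).
HB.instance Definition _ n := SubType.on (edge n).

(** A graph is the multiset of its edges; the vertex set is 'I_n, that is,
    [n] shifted to start at 0. *)
Definition graph (n : nat) := {mset edge n}%mset.

HB.instance Definition _ n := Choice.on (graph n).

Definition is_loop n (e : edge n) := (val e).1 == (val e).2.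

Definition simple_graph n (G : graph n) :=
  (forall e, e \in G -> ~~ is_loop e) /\ (forall e, (G e <= 1)%N).

(** The basis of the space of graphs: graphs with vertex set [n] for some
    n >= 1, the tag of a graph being n - 1. *)
Definition any_graph := {n : nat & graph n.+1}.

HB.instance Definition _ := Choice.on any_graph.

Definition edge_widen n N (leqnN : (n <= N)%N) (e : edge n) : edge N :=
  Sub (widen_ord leqnN (val e).1, widen_ord leqnN (val e).2) (valP e).

Definition graph_extend n N (leqnN : (n <= N)%N) (G : graph N) (H : graph n) :
    graph N :=
  (G `+` seq_mset [seq edge_widen leqnN e | e <- enum_mset H])%mset.

(** Formal power series in countably many variables, as functions from
    monomials to coefficients; the variable indexed by i is x_(i+1). *)
Definition series (K : comNzRingType) := {cmonom nat} -> K^o.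

HB.instance Definition _ (K : comNzRingType) := GRing.Lmodule.on (series K).

(** Invariance under all permutations of the variables, and bounded degree.
    Over {poly C} this gives Lambda[t]: a symmetric series of bounded degree has
    only finitely many distinct coefficients. *)
Definition symmetric_pred (K : comNzRingType) : {pred series K} :=
  fun p => `[<
    (forall s : nat -> nat, bijective s ->
       forall m m' : {cmonom nat}, (forall i, m' i = m (s i)) -> p m' = p m)
    /\ (exists d : nat, forall m, (d < mdeg m)%N -> p m = 0) >].

Lemma symmetric_pred_submod (K : comNzRingType) :
  submod_closed (@symmetric_pred K).
Proof.
split=> [|a p q /asboolP[ps [dp pb]] /asboolP[qs [dq qb]]]; apply/asboolP; split.
- by [].
- by exists 0%N.
- move=> s bs m m' mm'.
  by rewrite /= -[LHS]/(a * p m' + q m') (ps s bs m m' mm') (qs s bs m m' mm').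
- exists (maxn dp dq) => m; rewrite gtn_max => /andP[hp hq].
  by rewrite -[LHS]/(a * p m + q m) pb // qb // mulr0 addr0.
Qed.

HB.instance Definition _ (K : comNzRingType) :=
  GRing.isSubmodClosed.Build K (series K) (@symmetric_pred K)
    (symmetric_pred_submod K).

Record symfun (K : comNzRingType) :=
  SymFun { symfun_val :> series K; _ : symfun_val \in @symmetric_pred K }.

HB.instance Definition _ (K : comNzRingType) := [isSub for @symfun_val K].
HB.instance Definition _ (K : comNzRingType) := [Choice of symfun K by <:].
HB.instance Definition _ (K : comNzRingType) :=
  [SubChoice_isSubLmodule of symfun K by <:].

Definition coloring (n : nat) := {ffun 'I_n -> nat}.

HB.instance Definition _ n := Choice.on (coloring n).

Definition color_monom n (k : coloring n) : {cmonom nat} :=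
  \big[mmul/mone]_(v < n) ucm (k v).

(** The series \sum_(k in A) c k * \prod_v x_(k v), coefficient by coefficient:
    only finitely many colourings contribute to a given monomial. *)
Definition color_series (K : comNzRingType) n
    (A : set (coloring n)) (c : coloring n -> K) : series K :=
  fun m => \sum_(k \in [set k | A k /\ color_monom k = m]) c k.

Definition recolor n (s : nat -> nat) (k : coloring n) : coloring n :=
  [ffun v => s (k v)].

Lemma color_monomE n (k : coloring n) i :
  color_monom k i = (\sum_(v < n) (k v == i))%N.
Proof.
rewrite /color_monom; elim/big_rec2: _ => [|v m x _ <-]; first by rewrite cm1.
by rewrite cmM cmU.
Qed.

Lemma mdeg_color_monom n (k : coloring n) : mdeg (color_monom k) = n.
Proof.
rewrite /color_monom mdeg_prod (eq_bigr (fun=> 1%N)) => [|v _].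
  by rewrite sum1_card card_ord.
exact: mdegU.
Qed.

Lemma finite_color_monom n (A : set (coloring n)) (m : {cmonom nat}) :
  finite_set [set k : coloring n | A k /\ color_monom k = m].
Proof.
pose h (f : {ffun 'I_n -> finsupp m}) : coloring n := [ffun v => val (f v)].
apply: (@sub_finite_set _ _ (range h)); last exact/finite_image/finite_finset.
move=> k [_ km].
have kP v : k v \in finsupp m.
  by rewrite -km -cmE_neq0 color_monomE (bigD1 v) //= eqxx.
exists [ffun v => [` kP v]%fset] => //.
by apply/ffunP => v; rewrite !ffunE.
Qed.

Lemma color_series_sym (K : comNzRingType) n
    (A : set (coloring n)) (c : coloring n -> K) :
  (forall s k, injective s -> A (recolor s k) <-> A k) ->
  (forall s k, injective s -> c (recolor s k) = c k) ->
  color_series A c \in @symmetric_pred K.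
Proof.
move=> As cs; apply/asboolP; split=> [s bs m m' mm'|]; last first.
  exists n => m; rewrite /color_series => nm; apply: fsbig1 => k [_ km].
  by move: nm; rewrite -km mdeg_color_monom ltnn.
have sI := bij_inj bs.
pose h := @recolor n s.
rewrite /color_series [RHS](@reindex_fsbig _ _ _ _ _ h
  [set k | A k /\ color_monom k = m']); last first.
  have hm k : (color_monom (h k) = m) <-> (color_monom k = m').
    have E i : color_monom (h k) (s i) = color_monom k i.
      by rewrite !color_monomE; apply: eq_bigr => v _; rewrite ffunE (inj_eq sI).
    split=> [km|km]; apply/eqP/cmP => i; first by rewrite -E km mm'.
    by case: bs => t _ tK; rewrite -(tK i) E km mm'.
  split=> [k [Ak /hm km]|k k' _ _ /ffunP e|k [Ak km]].
  - by split=> //; exact: (As s k sI).2.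
  - by apply/ffunP => v; have := e v; rewrite !ffunE => /sI.
  - case: (bs) => t _ tK.
    have hk : h (recolor t k) = k by apply/ffunP=> v; rewrite !ffunE tK.
    exists (recolor t k) => //; split; last by apply/hm; rewrite hk.
    by apply: (As s _ sI).1; rewrite -/h hk.
by apply: eq_fsbigr => k _; rewrite cs.
Qed.

Definition monochromatic n (k : coloring n) (e : edge n) :=
  k (val e).1 == k (val e).2.

Definition proper_colorings n (G : graph n) : set (coloring n) :=
  [set k | forall e, e \in G -> ~~ monochromatic k e].

Definition num_mono n (G : graph n) (k : coloring n) : nat :=
  (\sum_(e : edge n | monochromatic k e) G e)%N.

Lemma monochromatic_inj n s (k : coloring n) e : injective s ->
  monochromatic (recolor s k) e = monochromatic k e.
Proof. by move=> sI; rewrite /monochromatic !ffunE (inj_eq sI). Qed.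

Lemma chromatic_symmetric (K : comNzRingType) n (G : graph n) :
  color_series (proper_colorings G) (fun=> 1) \in @symmetric_pred K.
Proof.
apply: color_series_sym => // s k sI; split=> pk e /pk;
by rewrite monochromatic_inj.
Qed.

Lemma tutte_symmetric (K : comNzRingType) n (G : graph n) :
  color_series setT (fun k => (1 + 'X) ^+ num_mono G k)
    \in @symmetric_pred {poly K}.
Proof.
apply: color_series_sym => // s k sI; congr (_ ^+ _).
by apply: eq_bigl => e; rewrite monochromatic_inj.
Qed.

Definition chromatic_sf (K : comNzRingType) n (G : graph n) : symfun K :=
  SymFun (chromatic_symmetric K G).

Definition tutte_sf (K : comNzRingType) n (G : graph n) : symfun {poly K} :=
  SymFun (tutte_symmetric K G).

Definition X (K : comNzRingType) : {freeg any_graph / K} -> symfun K :=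
  fglift (fun G : any_graph => chromatic_sf K (tagged G)).

Definition XB (K : comNzRingType) :
    {freeg any_graph / {poly K}} -> symfun {poly K} :=
  fglift (fun G : any_graph => tutte_sf K (tagged G)).

Definition Ext (K : comNzRingType) n N (leqnN : (n < N.+1)%N)
    (L : {freeg (graph n.+1) / K}) (G : graph N.+1) : {freeg any_graph / K} :=
  fglift (fun H : graph n.+1 =>
    << Tagged (fun i => graph i.+1) (graph_extend leqnN G H) >>) L.

(** A linear combination of graphs that all have vertex set [n+1] is an element
    of the free module on [graph n.+1]. *)
Definition modular_relation_X (K : comNzRingType) n
    (L : {freeg (graph n.+1) / K}) :=
  forall N (leqnN : (n < N.+1)%N) (G : graph N.+1), X (Ext leqnN L G) = 0.

Definition modular_relation_XB (K : comNzRingType) n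
    (L : {freeg (graph n.+1) / {poly K}}) :=
  forall N (leqnN : (n < N.+1)%N) (G : graph N.+1), XB (Ext leqnN L G) = 0.

(* Main.v *)
(** If [e] is an edge of [H1] but not of [H2], let [G] be the complete graph
    minus [e], on the same vertices.  Then [G] together with [H1] contains the
    complete graph, so all its proper colourings are injective, while [G]
    together with [H2] has a proper colouring whose only coincidence is at the
    ends of [e].  The monomial of that colouring distinguishes the two chromatic
    symmetric functions.  The Tutte symmetric function specializes to the
    chromatic one at [t = -1]. *)
Require Import Defs.
From mathcomp Require Import all_boot all_order all_algebra finmap multiset.
From mathcomp Require Import boolp classical_sets fsbigop.
From mathcomp Require Import reals complex freeg.

Set Implicit Arguments.

Import Order.TTheory GRing.Theory Num.Theory.
Local Open Scope ring_scope.

Lemma fglift_sub (K : comNzRingType) (T : choiceType) (M : lmodType K)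
    (f : T -> M) (x y : T) :
  fglift f (<<x>> - <<y>> : {freeg T / K}) = f x - f y.
Proof. by rewrite lift_is_additive !liftU !scale1r. Qed.

Lemma X_Ext_sub (K : comNzRingType) n N (leqnN : (n < N.+1)%N)
    (H1 H2 : graph n.+1) (G : graph N.+1) :
  X (Ext leqnN (<<H1>> - <<H2>> : {freeg (graph n.+1) / K}) G) =
  chromatic_sf K (graph_extend leqnN G H1)
    - chromatic_sf K (graph_extend leqnN G H2).
Proof. by rewrite /Ext fglift_sub /X fglift_sub. Qed.

Lemma XB_Ext_sub (K : comNzRingType) n N (leqnN : (n < N.+1)%N)
    (H1 H2 : graph n.+1) (G : graph N.+1) :
  XB (Ext leqnN (<<H1>> - <<H2>> : {freeg (graph n.+1) / {poly K}}) G) =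
  tutte_sf K (graph_extend leqnN G H1) - tutte_sf K (graph_extend leqnN G H2).
Proof. by rewrite /Ext fglift_sub /XB fglift_sub. Qed.

Lemma num_mono_eq0 n (G : graph n) (k : coloring n) :
  (num_mono G k == 0)%N = (k \in proper_colorings G).
Proof.
rewrite /num_mono sum_nat_eq0; apply/forall_inP/idP => [G0|/set_mem kG e ke].
  apply/mem_set => e eG; apply/negP => /G0.
  by apply/negP; rewrite -lt0n -in_mset.
by rewrite eqn0Ngt -in_mset; apply/negP => /kG; rewrite ke.
Qed.

(** At [t = -1] a colouring has weight [0 ^+ num_mono G k]. Since [0 ^+ 0 = 1], exactly the proper
    colourings survive, each with weight 1. *)
Lemma tutte_chromatic (K : comNzRingType) n (G : graph n) m :
  (symfun_val (tutte_sf K G) m : {poly K}).[-1] =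
    symfun_val (chromatic_sf K G) m.
Proof.
rewrite /= /color_series fsbig_finite; last exact: finite_color_monom.
rewrite horner_sum -fsbig_finite; last exact: finite_color_monom.
rewrite (eq_fsbigr (fun k => if k \in proper_colorings G then 1 else 0)).
  by rewrite -fsbig_mkcondr; apply: eq_fsbigl; apply/seteqP; split=> k /=; tauto.
move=> k _; rewrite horner_exp hornerD hornerX hornerC subrr expr0n.
by rewrite num_mono_eq0; case: ifP.
Qed.

Lemma chromatic_coeff_eq0 (K : comNzRingType) n (G : graph n) m :
  (forall k, proper_colorings G k -> color_monom k <> m) ->
  symfun_val (chromatic_sf K G) m = 0.
Proof.
by move=> Gm; apply: fsbig1 => k [kG km]; case: (Gm k kG).
Qed.

(** The coefficient is a sum of ones, one of them contributed by [k]; in a [numDomainType] such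
    terms cannot cancel. *)
Lemma chromatic_coeff_neq0 (K : numDomainType) n (G : graph n)
    (k : coloring n) :
  proper_colorings G k -> symfun_val (chromatic_sf K G) (color_monom k) != 0.
Proof.
move=> kG; rewrite gt_eqF //= /color_series (fsbigD1 k) //=; last first.
  exact: finite_color_monom.
by rewrite ltr_pwDl ?ltr01 // fsumr_ge0.
Qed.

Lemma edge_widen_id n (le_nn : (n <= n)%N) (e : edge n) : edge_widen le_nn e = e.
Proof.
by apply: val_inj; case: e => -[i j] ij /=; congr pair; apply: val_inj.
Qed.

(** Without new vertices widening is the identity. Membership suffices later, as properness ignores
    multiplicities. *)
Lemma in_graph_extend n (le_nn : (n <= n)%N) (G H : graph n) (e : edge n) :
  (e \in graph_extend le_nn G H) = (e \in G) || (e \in H).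
Proof.
rewrite /graph_extend in_msetD (eq_map (edge_widen_id le_nn)) map_id.
by rewrite seq_mset_id.
Qed.

Definition complete_but n (e : edge n) : graph n :=
  seq_mset [seq f <- enum {: edge n} | ~~ is_loop f && (f != e)].

Lemma in_complete_but n (e f : edge n) :
  (f \in complete_but e) = ~~ is_loop f && (f != e).
Proof.
by rewrite (perm_mem (perm_eq_seq_mset _)) mem_filter mem_enum andbT.
Qed.

Lemma all_edges_injective n (G : graph n) (k : coloring n) :
  (forall f, ~~ is_loop f -> f \in G) -> proper_colorings G k -> injective k.
Proof.
move=> Gall kG.
(* Edges list their ends in increasing order, so a pair must be sorted before it yields an edge. *)
suff lt_neq (i j : 'I_n) : (i < j)%N -> k i != k j.
  move=> i j kij; apply/val_inj; case: (ltngtP i j) => // /lt_neq;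
  by rewrite kij eqxx.
move=> ij; pose f : edge n := Sub (i, j) (ltnW ij).
by apply: (kG f); apply: Gall; rewrite /is_loop /= -val_eqE /= ltn_eqF.
Qed.

Definition merge_coloring n (e : edge n) : coloring n :=
  [ffun v => if v == (val e).2 then val (val e).1 else val v].

Lemma monochromatic_merge n (e f : edge n) :
  monochromatic (merge_coloring e) f -> is_loop f \/ f = e.
Proof.
case: e f => -[u v] /= uv [[i j] /= ij].
rewrite /monochromatic /is_loop !ffunE /=.
case: (eqVneq i v) => [iv|iv]; case: (eqVneq j v) => [jv|jv] /eqP /val_inj E.
- by left; rewrite iv jv.
(* The ordering of ends excludes this case: equal colours give [j = u], so [j = u <= v = i <= j],
   whence [j = v]. *)
- case/eqP: jv; apply/val_inj/anti_leq.
  by rewrite -{1}E uv -iv ij.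
- by right; apply: val_inj; rewrite /= E jv.
- by left; apply/eqP.
Qed.

Lemma color_monom_count n (k k' : coloring n) (i : nat) :
  color_monom k = color_monom k' ->
  (\sum_(v < n) (k v == i) = \sum_(v < n) (k' v == i))%N.
Proof. by rewrite -!color_monomE => ->. Qed.

(** The exponent of the variable indexed by [(val e).1] separates the monomials: both ends of [e]
    take this colour under the merged colouring, at most one vertex does under an injective one. *)
Lemma merge_monom_not_injective n (e : edge n) (k : coloring n) :
  ~~ is_loop e -> injective k -> color_monom k <> color_monom (merge_coloring e).
Proof.
rewrite /is_loop => uv kI /(@color_monom_count _ _ _ (val e).1) E.
have: (1 < \sum_(v < n) (merge_coloring e v == (val e).1 :> nat))%N.
  rewrite (bigD1 (val e).1) //= (bigD1 (val e).2) //= 1?eq_sym //.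
  by rewrite !ffunE eqxx (negPf uv) !eqxx.
rewrite -{}E; apply/negP; rewrite -leqNgt.
case: (pickP (fun v => k v == (val e).1)) => [w /eqP <-|k0].
  rewrite (bigD1 w) //= eqxx big1 // => v vw.
  by rewrite (inj_eq kI) (negPf vw).
by rewrite big1 // => v _; rewrite k0.
Qed.

Lemma chromatic_complete_but (K : numDomainType) n (le_nn : (n <= n)%N)
    (H1 H2 : graph n) (e : edge n) :
    (forall f, f \in H1 -> ~~ is_loop f) ->
    (forall f, f \in H2 -> ~~ is_loop f) -> e \in H1 -> e \notin H2 ->
  chromatic_sf K (graph_extend le_nn (complete_but e) H1)
    != chromatic_sf K (graph_extend le_nn (complete_but e) H2).
Proof.
move=> H1l H2l eH1 eH2; pose k := merge_coloring e.
suff kH2 : proper_colorings (graph_extend le_nn (complete_but e) H2) k.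
  apply: contraTneq (chromatic_coeff_neq0 K kH2) => <-.
  rewrite chromatic_coeff_eq0 ?eqxx // => k' /all_edges_injective k'I.
  apply: merge_monom_not_injective; first exact: H1l.
  apply: k'I => f fl; rewrite in_graph_extend in_complete_but fl /=.
  by case: eqVneq => // ->.
(* A monochromatic [f] would be a loop or [e] itself, and neither occurs in [complete_but e] or in
   [H2]. *)
move=> f; rewrite in_graph_extend in_complete_but => fG; apply/negP.
case/monochromatic_merge => [fl|fe]; move: fG.
  by rewrite fl /= => /H2l; rewrite fl.
by rewrite fe eqxx andbF (negPf eH2).
Qed.

(** With all multiplicities at most 1, a graph is determined by the support of its edge multiset. *)
Lemma simple_graph_neq n (H1 H2 : graph n) :
  simple_graph H1 -> simple_graph H2 -> H1 <> H2 ->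
  exists e, (e \in H1) != (e \in H2).
Proof.
move=> [_ H1s] [_ H2s] H12; apply/existsP; rewrite -[X in is_true X]negbK.
rewrite negb_exists; apply/forallP => H; apply: H12; apply/msetP => e.
have := H e; rewrite negbK !in_mset.
by case: (H1 e) (H2 e) (H1s e) (H2s e) => [|[]] // [|[]].
Qed.

Lemma chromatic_extension_neq (K : numDomainType) n (le_nn : (n <= n)%N)
    (H1 H2 : graph n) :
    simple_graph H1 -> simple_graph H2 -> H1 <> H2 ->
  exists G, chromatic_sf K (graph_extend le_nn G H1)
    != chromatic_sf K (graph_extend le_nn G H2).
Proof.
move=> H1s H2s /(simple_graph_neq H1s H2s)[e He].
exists (complete_but e); case: H1s H2s => [H1l _] [H2l _].
have [eH1|eH1] := boolP (e \in H1).
  by apply: chromatic_complete_but => //; move: He; rewrite eH1.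
(* Here [e] lies in [H2] only, so the two graphs exchange roles. *)
rewrite eq_sym; apply: chromatic_complete_but => //.
by move: He; rewrite (negPf eH1); case: (e \in H2).
Qed.

Unset Implicit Arguments.

Theorem corollary7 (R : realType) (n : nat) (H1 H2 : graph n.+1)
    (H1_simple : simple_graph H1) (H2_simple : simple_graph H2)
    (H1_neq_H2 : H1 <> H2) :
  ~ modular_relation_X (<<H1>> - <<H2>> : {freeg (graph n.+1) / R[i]})
  /\ ~ modular_relation_XB
         (<<H1>> - <<H2>> : {freeg (graph n.+1) / {poly R[i]}}).
Proof.
(* The term [leqnn n.+1] also proves [n < n.+1], the form required by [Ext] when no vertex is
   added. *)
have [G /eqP neqG] := chromatic_extension_neq R[i] (leqnn n.+1)
  H1_simple H2_simple H1_neq_H2.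
split=> /(_ n (leqnn n.+1) G).
  by rewrite X_Ext_sub => /subr0_eq.
(* Equal Tutte functions have equal coefficients, and evaluating these at -1 would equate the
   chromatic functions. *)
rewrite XB_Ext_sub => /subr0_eq EB; apply/neqG/val_inj/funext => m /=.
by rewrite -[LHS]tutte_chromatic EB tutte_chromatic.
Qed.
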